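(* Let $\mathfrak{g}=\mathfrak{h}(\lambda,\mu,\varphi,\operatorname{ad}_{\mathfrak{h}}^{\ast})$ be a non-abelian nilpotent quadratic Lie algebra on the vector space $\mathfrak{h}\oplus\mathfrak{a}\oplus\mathfrak{h}^{\ast}$, where $\mathfrak{i}(\mathfrak{g})=\mathfrak{h}^{\ast}$ and $\mathfrak{J}(\mathfrak{g})=\mathfrak{a}\oplus\mathfrak{h}^{\ast}$ are the canonical ideals of $\mathfrak{g}$. Let $\mathcal{S}$ be a finite dimensional commutative and associative algebra with unit $1$ over $\mathbb{F}$. If the current Lie algebra $\mathfrak{g}\otimes\mathcal{S}$ admits an invariant metric and $\mathfrak{h}$ is non-abelian, then there exists a bilinear map $\epsilon:\mathcal{S}\times\mathcal{S}\to\operatorname{Cent}(\mathfrak{h})$ such that: (i) $\epsilon(s,t)=\epsilon(st,1)$ for all $s,t\in\mathcal{S}$; (ii) if $s\in\mathcal{S}$ satisfies $\epsilon(s,t)=0$ for all $t\in\mathcal{S}$, then $s=0$.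
   Context: All algebras and vector spaces are finite dimensional over a field $\mathbb{F}$ of characteristic zero. An invariant metric on a Lie algebra $\mathfrak{g}$ is a non-degenerate symmetric bilinear form $B$ with $B([x,y],z)=-B(y,[x,z])$ for all $x,y,z$; a quadratic Lie algebra is a Lie algebra equipped with an invariant metric. The current Lie algebra $\mathfrak{g}\otimes\mathcal{S}$ has bracket $[X\otimes s,Y\otimes t]=[X,Y]\otimes st$. The centroid is $\operatorname{Cent}(\mathfrak{h})=\{T\in\mathfrak{gl}(\mathfrak{h})\mid T([x,y]_{\mathfrak{h}})=[x,T(y)]_{\mathfrak{h}}\ \forall x,y\in\mathfrak{h}\}$. Canonical ideals: let $Z_1(\mathfrak{g})=Z(\mathfrak{g})\subset Z_2(\mathfrak{g})\subset\cdots$ be the ascending central series ($Z_{\ell}(\mathfrak{g})$ is the preimage in $\mathfrak{g}$ of the center of $\mathfrak{g}/Z_{\ell-1}(\mathfrak{g})$) and $\mathfrak{g}^0=\mathfrak{g}$, $\mathfrak{g}^{\ell}=[\mathfrak{g},\mathfrak{g}^{\ell-1}]$ for $\ell\ge1$. Then $\mathfrak{i}(\mathfrak{g})=\sum_{k\ge1}Z_k(\mathfrak{g})\cap\mathfrak{g}^k$ and $\mathfrak{J}(\mathfrak{g})=\bigcap_{k\ge1}(Z_k(\mathfrak{g})+\mathfrak{g}^k)$. The Lie algebra $\mathfrak{h}(\lambda,\mu,\varphi,\operatorname{ad}_{\mathfrak{h}}^{\ast})$: the data are a Lie algebra $(\mathfrak{h},[\cdot,\cdot]_{\mathfrak{h}})$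 with coadjoint representation $\operatorname{ad}_{\mathfrak{h}}^{\ast}(x)(\alpha)=-\alpha\circ\operatorname{ad}_{\mathfrak{h}}(x)$ on $\mathfrak{h}^{\ast}$; a vector space $\mathfrak{a}$ (trivial $\mathfrak{h}$-module); a linear map $\varphi:\mathfrak{h}\to\operatorname{Hom}(\mathfrak{a},\mathfrak{h}^{\ast})$ with $\varphi([x,y]_{\mathfrak{h}})=\operatorname{ad}_{\mathfrak{h}}^{\ast}(x)\circ\varphi(y)-\operatorname{ad}_{\mathfrak{h}}^{\ast}(y)\circ\varphi(x)$; and skew-symmetric bilinear maps $\lambda:\mathfrak{h}\times\mathfrak{h}\to\mathfrak{a}$, $\mu:\mathfrak{h}\times\mathfrak{h}\to\mathfrak{h}^{\ast}$ satisfying $\mathrm{d}_{\mathfrak{a}}(\lambda)=0$ and $e_\varphi(\lambda)+\mathrm{d}_{\operatorname{ad}_{\mathfrak{h}}^{\ast}}(\mu)=0$. Here $\mathrm{d}_{\mathfrak{a}}$, $\mathrm{d}_{\operatorname{ad}_{\mathfrak{h}}^{\ast}}$ are the Chevalley–Eilenberg differentials of $\mathfrak{h}$ with values in the trivial module $\mathfrak{a}$ and in the coadjoint module $\mathfrak{h}^{\ast}$, and $e_\varphi(\lambda)(x,y,z)=\varphi(x)(\lambda(y,z))+\varphi(y)(\lambda(z,x))+\varphi(z)(\lambda(x,y))$. The Lie bracket on $\mathfrak{h}\oplus\mathfrak{a}\oplus\mathfrak{h}^{\ast}$ is the skew-symmetric bilinear map with $[x,y]=[x,y]_{\mathfrak{h}}+\lambda(x,y)+\mu(x,y)$,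 $[x,u+\alpha]=\varphi(x)(u)+\operatorname{ad}_{\mathfrak{h}}^{\ast}(x)(\alpha)$, $[u+\alpha,v+\beta]=0$. *)

(* Defs.v *)
From HB Require Import structures.
From mathcomp Require Import all_boot all_order all_algebra all_field.
From mathcomp Require Import ring.

Set Implicit Arguments.
Unset Strict Implicit.
Unset Printing Implicit Defensive.

Import GRing.Theory.
Local Open Scope ring_scope.

Section LieAlgebras.
Variables (F : fieldType) (L : vectType F) (br : {bilinear L -> L -> L}).

Definition is_lie_bracket : Prop :=
  (forall x, br x x = 0) /\
  (forall x y z, br x (br y z) + br y (br z x) + br z (br x y) = 0).

Definition abelian_lie : Prop := forall x y, br x y = 0.

Definition in_centroid (T : 'End(L)) : Prop :=
  forall x y, T (br x y) = br x (T y).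

Definition bracketv (U V : {vspace L}) : {vspace L} :=
  <<[seq br u v | u <- vbasis U, v <- vbasis V]>>%VS.

(* lcs k is g^k: indexing starts at lcs 0 = g, so that lcs 1 = [g, g]. *)
Fixpoint lcs (k : nat) : {vspace L} :=
  if k is k'.+1 then bracketv fullv (lcs k') else fullv.

(* {x | [x, L] <= U}: the preimage of the centre of L / U when U is an ideal
   (see centerv_modP). *)
Definition centerv_mod (U : {vspace L}) : {vspace L} :=
  (\bigcap_(i < \dim {:L}) (linfun (applyr br (vbasis {:L})`_i) @^-1: U))%VS.

(* ucs 0 = 0 and ucs 1 = Z(g). *)
Fixpoint ucs (k : nat) : {vspace L} :=
  if k is k'.+1 then centerv_mod (ucs k') else 0%VS.

Definition nilpotent_lie : Prop := exists k, lcs k = 0%VS.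

(* The sum of Z_k :&: g^k over all k >= 1 is the increasing union of its finite
   partial sums. *)
Definition in_ideal_i (x : L) : Prop :=
  exists n, x \in (\sum_(1 <= k < n) (ucs k :&: lcs k))%VS.

Definition in_ideal_J (x : L) : Prop :=
  forall k, (0 < k)%N -> x \in (ucs k + lcs k)%VS.

Definition invariant_metric (B : {symmetric L}) : Prop :=
  nondegenerate B /\ forall x y z, B (br x y) z = - B y (br x z).

Definition admits_invariant_metric : Prop :=
  exists B : {symmetric L}, invariant_metric B.

Lemma bracketvP (U V W : {vspace L}) :
  reflect (forall u v, u \in U -> v \in V -> br u v \in W)
    (bracketv U V <= W)%VS.
Proof.
apply: (iffP idP) => [sW u v uU vV|H]; last first.
  apply/span_subvP => _ /allpairsP[[u v] /= [uU vV ->]].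
  by apply: H; exact: vbasis_mem.
apply: (subvP sW); rewrite (coord_vbasis uU) (coord_vbasis vV).
rewrite linear_sumlz; apply: memv_suml => i _.
rewrite linear_sumr; apply: memv_suml => j _.
rewrite linearZr_LR linearZl_LR; do 2 apply: memvZ.
by apply: memv_span; apply/allpairsP; exists ((vbasis U)`_i, (vbasis V)`_j);
  split=> //=; apply: mem_nth; rewrite size_tuple.
Qed.

Lemma centerv_modP (U : {vspace L}) x :
  reflect (forall y, br x y \in U) (x \in centerv_mod U).
Proof.
apply: (iffP idP) => [xU y|H]; last first.
  by rewrite memvE; apply/subv_bigcapP => i _; rewrite -memvE -memv_preim lfunE /=.
rewrite (coord_vbasis (memvf y)) linear_sumr; apply: memv_suml => i _.
rewrite linearZr_LR; apply: memvZ; move: xU; rewrite memvE.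
by move/subv_bigcapP/(_ i isT); rewrite -memvE -memv_preim lfunE.
Qed.

Lemma symmetricP (B : {symmetric L}) x y : B x y = B y x.
Proof. by rewrite hermC expr0 mul1r. Qed.

Lemma nondegenerateP (B : {symmetric L}) :
  reflect (forall x, (forall y, B x y = 0) -> x = 0) (nondegenerate B).
Proof.
rewrite /nondegenerate -subv0; apply: (iffP subvP) => [B0 x xB|B0 x xR].
  by apply/eqP; rewrite -memv0; apply: B0; apply/mem_orthovP => y _; exact: xB.
rewrite memv0; apply/eqP/B0 => y.
by move/mem_orthovP: xR; apply; exact: memvf.
Qed.

End LieAlgebras.

(* U (x) V, realized as the space of coordinate matrices with respect to the
   bases vbasis {:U} and vbasis {:V}; tens_universal is its universal property. *)
Section Tensor.
Variables (F : fieldType) (U V : vectType F).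

Definition tensor := 'M[F]_(\dim {:U}, \dim {:V}).
HB.instance Definition _ := Vector.on tensor.

Definition tens (u : U) (v : V) : tensor :=
  \matrix_(i, j) (coord (vbasis {:U}) i u * coord (vbasis {:V}) j v).

Lemma tens_is_bilinear :
  (forall v, linear (tens^~ v)) * (forall u, linear (tens u)).
Proof.
split=> [v|u] c x y; apply/matrixP=> i j; rewrite !mxE linearP.
  by rewrite mulrDl -mulrA.
by rewrite mulrDr mulrCA.
Qed.

HB.instance Definition _ := isBilinear.Build F U V tensor *:%R *:%R tens
  (fun y => zmod_morphism_linear (tens_is_bilinear.1 y))
  (fun x => zmod_morphism_linear (tens_is_bilinear.2 x))
  (fun y => scalable_linear (tens_is_bilinear.1 y))
  (fun x => scalable_linear (tens_is_bilinear.2 x)).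

End Tensor.

Definition basisv (F : fieldType) (U : vectType F) (i : 'I_(\dim {:U})) : U :=
  (vbasis {:U})`_i.

Lemma coord_basisv (F : fieldType) (U : vectType F) (u : U) :
  u = \sum_i coord (vbasis {:U}) i u *: basisv i.
Proof. exact: coord_vbasis (memvf u). Qed.

Lemma tens_basisv (F : fieldType) (U V : vectType F) (i : 'I_(\dim {:U}))
  (j : 'I_(\dim {:V})) : tens (basisv i) (basisv j) = delta_mx i j.
Proof.
apply/matrixP=> k l; rewrite !mxE !coord_free ?(basis_free (vbasisP _)) //.
by rewrite -natrM mulnb [i == k]eq_sym [j == l]eq_sym.
Qed.

Lemma tensor_sum (F : fieldType) (U V : vectType F) (X : tensor U V) :
  X = \sum_i \sum_j X i j *: tens (basisv i) (basisv j).
Proof.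
rewrite {1}(matrix_sum_delta X); apply: eq_bigr => i _; apply: eq_bigr => j _.
by rewrite tens_basisv.
Qed.

Lemma tensor_ind (F : fieldType) (U V : vectType F) (P : tensor U V -> Prop) :
  P 0 -> (forall X Y, P X -> P Y -> P (X + Y)) ->
  (forall u v, P (tens u v)) -> forall X, P X.
Proof.
move=> P0 PD Pt X; rewrite (tensor_sum X).
apply: big_ind => // i _; apply: big_ind => // j _.
by have := Pt (X i j *: basisv i) (basisv j); rewrite linearZl_LR.
Qed.

Lemma tens_universal (F : fieldType) (U V W : vectType F)
    (f : {bilinear U -> V -> W}) :
  exists! g : 'Hom(tensor U V, W), forall u v, g (tens u v) = f u v.
Proof.
pose g (X : tensor U V) := \sum_i \sum_j X i j *: f (basisv i) (basisv j).
have g_lin : linear g.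
  move=> c X Y; rewrite /g scaler_sumr -big_split; apply: eq_bigr => i _ /=.
  rewrite scaler_sumr -big_split; apply: eq_bigr => j _ /=.
  by rewrite !mxE scalerDl scalerA.
pose gL := GRing.isLinear.Build _ _ _ _ g g_lin.
pose G : {linear tensor U V -> W} := HB.pack g gL.
exists (linfun G); split=> [u v|g' g'E].
  rewrite lfunE /= /g [in RHS](coord_basisv u) [in RHS](coord_basisv v).
  rewrite linear_sumlz; apply: eq_bigr => i _.
  rewrite linear_sumr; apply: eq_bigr => j _.
  by rewrite linearZr_LR linearZl_LR scalerA mxE mulrC.
apply/lfunP => X; rewrite lfunE /= /g [in RHS](tensor_sum X) linear_sum.
apply: eq_bigr => i _; rewrite linear_sum; apply: eq_bigr => j _.
by rewrite linearZ /= g'E.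
Qed.

Section Current.
Variables (F : fieldType) (L : vectType F) (S : falgType F).
Variable br : {bilinear L -> L -> L}.

(* The bilinear extension of [x (x) s, y (x) t] = [x, y] (x) st, written in
   coordinates (see current_bracket_tens). *)
Definition current_bracket_fun (X Y : tensor L S) : tensor L S :=
  \sum_i \sum_j \sum_k \sum_l (X i j * Y k l) *:
    tens (br (basisv i) (basisv k)) (basisv j * basisv l).

Lemma current_bracket_is_bilinear :
  (forall y, linear (current_bracket_fun^~ y)) *
  (forall x, linear (current_bracket_fun x)).
Proof.
split=> [Y|X] c A B; rewrite /current_bracket_fun /=;
  do 4 (rewrite scaler_sumr -big_split; apply: eq_bigr => ? _ /=);
  rewrite !mxE scalerA -scalerDl; congr (_ *: _).
  by rewrite mulrDl mulrA.
by rewrite mulrDr mulrCA.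
Qed.

HB.instance Definition _ := isBilinear.Build F
  (tensor L S) (tensor L S) (tensor L S) *:%R *:%R current_bracket_fun
  (fun y => zmod_morphism_linear (current_bracket_is_bilinear.1 y))
  (fun x => zmod_morphism_linear (current_bracket_is_bilinear.2 x))
  (fun y => scalable_linear (current_bracket_is_bilinear.1 y))
  (fun x => scalable_linear (current_bracket_is_bilinear.2 x)).

Definition current_bracket :
  {bilinear tensor L S -> tensor L S -> tensor L S} := current_bracket_fun.

Lemma current_bracket_tens x y s t :
  current_bracket (tens x s) (tens y t) = tens (br x y) (s * t).
Proof.
rewrite [in RHS](coord_basisv x) linear_sumlz linear_sumlz.
apply: eq_bigr => i _.
rewrite [in RHS](coord_basisv s) mulr_suml linear_sumr.
apply: eq_bigr => j _.
rewrite [in RHS](coord_basisv y) linear_sumr linear_sumlz.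
apply: eq_bigr => k _.
rewrite [in RHS](coord_basisv t) mulr_sumr linear_sumr.
apply: eq_bigr => l _.
rewrite !(linearZl_LR, linearZr_LR) -scalerAl -scalerAr.
rewrite !(linearZl_LR, linearZr_LR) !scalerA; congr (_ *: _).
rewrite !mxE.
by rewrite -!mulrA; congr (_ * _); rewrite mulrCA; congr (_ * _); rewrite mulrC.
Qed.

Lemma current_bracket_is_lie :
  commutative (@GRing.mul S) -> is_lie_bracket br ->
  is_lie_bracket current_bracket.
Proof.
move=> mulC [brxx jac].
have brC x y : br x y = - br y x.
  apply/eqP; rewrite -addr_eq0; apply/eqP.
  by have := brxx (x + y); rewrite linearDl !linearDr !brxx add0r addr0.
have cbC X Y : current_bracket X Y = - current_bracket Y X.
  elim/tensor_ind: X => [|X1 X2 IH1 IH2|x s].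
  - by rewrite linear0l linear0r oppr0.
  - by rewrite linearDl linearDr /= IH1 IH2 opprD.
  elim/tensor_ind: Y => [|Y1 Y2 IH1 IH2|y t].
  - by rewrite linear0l linear0r oppr0.
  - by rewrite linearDl linearDr /= IH1 IH2 opprD.
  by rewrite !current_bracket_tens brC linearNl mulC.
split=> [X|X Y Z].
  elim/tensor_ind: X => [|X1 X2 IH1 IH2|x s].
  - by rewrite linear0l.
  - by rewrite linearDl !linearDr /= IH1 IH2 (cbC X1) add0r addr0 addNr.
  by rewrite /= current_bracket_tens brxx linear0l.
elim/tensor_ind: X => [|X1 X2 IH1 IH2|x s].
- by rewrite !(linear0l, linear0r) !addr0.
- rewrite !(linearDl, linearDr) /=.
  by rewrite (addrACA (current_bracket X1 _)) [LHS]addrACA IH1 IH2 addr0.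
elim/tensor_ind: Y => [|Y1 Y2 IH1 IH2|y t].
- by rewrite !(linear0l, linear0r) !addr0.
- rewrite !(linearDl, linearDr) /=.
  rewrite (addrACA (current_bracket (tens x s) _)).
  by rewrite [LHS]addrACA IH1 IH2 addr0.
elim/tensor_ind: Z => [|Z1 Z2 IH1 IH2|z r].
- by rewrite !(linear0l, linear0r) !addr0.
- rewrite !(linearDl, linearDr) /=.
  rewrite (addrACA (current_bracket (tens x s) _)).
  by rewrite [LHS]addrACA IH1 IH2 addr0.
rewrite /= !current_bracket_tens.
have -> : t * (r * s) = s * (t * r) by rewrite mulrA mulC.
have -> : r * (s * t) = s * (t * r) by rewrite mulC -mulrA.
by rewrite -!linearDl jac linear0l.
Qed.

End Current.

Section CoadjointExtension.
Variables (F : fieldType) (h a : vectType F).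

Local Notation dual := 'Hom(h, F^o).

Definition ext_space := (h * a * dual)%type.
HB.instance Definition _ := Vector.on ext_space.

(* Differential of the 2-cochain c with values in the module (V, rho). *)
Definition ce_diff2 (V : vectType F) (br : h -> h -> h) (rho : h -> V -> V)
    (c : h -> h -> V) (x y z : h) : V :=
  rho x (c y z) - rho y (c x z) + rho z (c x y)
  - c (br x y) z + c (br x z) y - c (br y z) x.

Definition trivial_action (x : h) (u : a) : a := 0.

Variable br : {bilinear h -> h -> h}.

Definition coad (x : h) (alpha : dual) : dual := - (alpha \o linfun (br x))%VF.

Definition skew_map (V : vectType F) (c : h -> h -> V) : Prop :=
  forall x y, c x y = - c y x.

Variables (lam : {bilinear h -> h -> a}) (mu : {bilinear h -> h -> dual}).
Variable phi : {linear h -> 'Hom(a, dual)}.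

Definition e_phi (x y z : h) : dual :=
  phi x (lam y z) + phi y (lam z x) + phi z (lam x y).

Definition coadjoint_data : Prop :=
  [/\ forall x y u, phi (br x y) u = coad x (phi y u) - coad y (phi x u),
      skew_map lam, skew_map mu,
      forall x y z, ce_diff2 br trivial_action lam x y z = 0
    & forall x y z, e_phi x y z + ce_diff2 br coad mu x y z = 0].

(* (x, u, alpha) stands for x + u + alpha. *)
Definition ext_bracket_fun (p q : ext_space) : ext_space :=
  let: (x, u, alpha) := p in
  let: (y, v, beta) := q in
  (br x y, lam x y,
   mu x y + (phi x v + coad x beta) - (phi y u + coad y alpha)).

Lemma coadE x (alpha : dual) y : coad x alpha y = - alpha (br x y).
Proof. by rewrite opp_lfunE comp_lfunE lfunE. Qed.

Lemma coad_is_linear x : linear (coad x).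
Proof.
move=> c f g; apply/lfunP => y.
by rewrite !(coadE, add_lfunE, scale_lfunE) opprD -scalerN.
Qed.

Lemma coad_linearl alpha c x y :
  coad (c *: x + y) alpha = c *: coad x alpha + coad y alpha.
Proof.
apply/lfunP => z.
by rewrite !(coadE, add_lfunE, scale_lfunE) linearPl linearP opprD -scalerN.
Qed.

Lemma ext_spaceP (p q : ext_space) :
  p.1.1 = q.1.1 -> p.1.2 = q.1.2 -> p.2 = q.2 -> p = q.
Proof. by case: p q => [[? ?] ?] [[? ?] ?] /= -> -> ->. Qed.

Lemma ext_bracket_is_bilinear :
  (forall y, linear (ext_bracket_fun^~ y)) *
  (forall x, linear (ext_bracket_fun x)).
Proof.
have reorg (V : lmodType F) c (a1 a2 b1 b2 c1 c2 d1 d2 e1 e2 : V) :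
    c *: a1 + a2 + ((c *: b1 + b2) + (c *: c1 + c2))
      - ((c *: d1 + d2) + (c *: e1 + e2)) =
    c *: (a1 + (b1 + c1) - (d1 + e1)) + (a2 + (b2 + c2) - (d2 + e2)).
  rewrite [X in _ + X - _]addrACA [X in X - _]addrACA [X in _ - X]addrACA opprD.
  by rewrite [LHS]addrACA -!scalerDr -scalerBr.
split=> [[[y v] beta]|[[x u] alpha]] c [[x1 u1] al1] [[x2 u2] al2].
  apply: ext_spaceP; rewrite /= ?linearPl //.
  rewrite [phi (_ + _)]linearP add_lfunE scale_lfunE coad_linearl.
  by rewrite [phi y _]linearP coad_is_linear reorg.
apply: ext_spaceP; rewrite /= ?linearPr //.
rewrite [phi (_ + _)]linearP add_lfunE scale_lfunE coad_linearl.
by rewrite [phi x _]linearP coad_is_linear reorg.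
Qed.

HB.instance Definition _ := isBilinear.Build F
  ext_space ext_space ext_space
  *:%R *:%R ext_bracket_fun
  (fun y => zmod_morphism_linear (ext_bracket_is_bilinear.1 y))
  (fun x => zmod_morphism_linear (ext_bracket_is_bilinear.2 x))
  (fun y => scalable_linear (ext_bracket_is_bilinear.1 y))
  (fun x => scalable_linear (ext_bracket_is_bilinear.2 x)).

Definition ext_bracket :
  {bilinear ext_space -> ext_space -> ext_space} := ext_bracket_fun.

Lemma ext_bracket_dualE (p q : ext_space) t :
  (ext_bracket p q).2 t =
    mu p.1.1 q.1.1 t + (phi p.1.1 q.1.2 t - q.2 (br p.1.1 t))
      - (phi q.1.1 p.1.2 t - p.2 (br q.1.1 t)).
Proof.
case: p q => [[x u] al] [[y v] be] /=.
by rewrite add_lfunE opp_lfunE !add_lfunE !coadE.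
Qed.

Lemma ext_bracket_is_lie :
  [pchar F] =i pred0 -> is_lie_bracket br -> coadjoint_data ->
  is_lie_bracket ext_bracket.
Proof.
move=> char0 [brxx jac] [phiE lamC muC dlam dmu].
have skew0 (V : vectType F) (c : h -> h -> V) : skew_map c -> forall x, c x x = 0.
  move=> cC x; have /eqP := cC x x.
  rewrite -subr_eq0 opprK -mulr2n -scaler_nat scaler_eq0 => /orP[|/eqP//].
  by move=> c2; have := char0 2; rewrite !inE /= c2.
have brC x y : br x y = - br y x.
  apply/eqP; rewrite -addr_eq0; apply/eqP.
  by have := brxx (x + y); rewrite linearDl !linearDr !brxx add0r addr0.
split=> [[[x u] al]|[[x u] al] [[y v] be] [[z w] ga]].
  by rewrite /= brxx (skew0 _ _ lamC) (skew0 _ _ muC) add0r subrr.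
apply: ext_spaceP; [exact: jac| |apply/lfunP => t].
  rewrite /=; have := dlam x y z.
  rewrite /ce_diff2 /trivial_action subrr !add0r => <-.
  rewrite (lamC z (br x y)) addrC -addrA; congr (_ + _).
  rewrite (lamC x (br y z)) (lamC y (br z x)) (brC z x) linearNl opprK.
  exact: addrC.
have ev (f g : dual) : f = g -> f t = g t by move->.
have subE (f g : dual) : (f - g) t = f t - g t.
  by rewrite add_lfunE opp_lfunE.
have brJ (f : dual) p q :
    f (br (br p q) t) = f (br p (br q t)) - f (br q (br p t)).
  rewrite -linearB; congr (f _).
  rewrite -[LHS]addr0 -(jac p q t) (brC t (br p q)) (brC t p) linearNr.
  by rewrite addrC subrK.
have phiJ p q c : phi (br p q) c t = - phi q c (br p t) + phi p c (br q t).
  by rewrite phiE subE !coadE opprK.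
have dmuE : phi x (lam y z) t + phi y (lam z x) t + phi z (lam x y) t
    - mu y z (br x t) - mu z x (br y t) - mu x y (br z t)
    + mu x (br y z) t + mu y (br z x) t + mu z (br x y) t = 0.
  rewrite -[RHS](zero_lfunE _ t) -(ev _ _ (dmu x y z)) /e_phi /ce_diff2.
  rewrite (muC x z) (brC x z) linearNl.
  rewrite (muC x (br y z)) (muC y (br z x)) (muC z (br x y)).
  rewrite !(subE, add_lfunE) !opp_lfunE !(comp_lfunE, lfunE) /=.
  ring.
pose P : ext_space := (x, u, al); pose Q : ext_space := (y, v, be).
pose R : ext_space := (z, w, ga).
suff : (ext_bracket P (ext_bracket Q R)).2 t
    + (ext_bracket Q (ext_bracket R P)).2 t
    + (ext_bracket R (ext_bracket P Q)).2 t = 0.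
  by move=> E0; rewrite [RHS]zero_lfunE -[RHS]E0 -!add_lfunE.
rewrite !ext_bracket_dualE /= -[RHS]dmuE !phiJ !brJ.
ring.
Qed.

End CoadjointExtension.

(* Main.v *)
Require Import Defs.
From HB Require Import structures.
From mathcomp Require Import all_boot all_order all_algebra all_field.

Set Implicit Arguments.
Unset Strict Implicit.
Unset Printing Implicit Defensive.

Import GRing.Theory.
Local Open Scope ring_scope.

(** Write g for the extension h + a + h^*, i and J for its canonical ideals,
    B for its invariant metric and C for the one on the current algebra.  As B
    is non-degenerate, every pair s, t has a component D(s,t) in End(g), with
    B (D(s,t) x) y = C (x (x) s) (y (x) t), and it is bilinear in s and t.
    Invariance of B and C gives

      D(rs,t) [x,y] = [x, D(s,rt) y]          (component_bracket).

    With r = 1 this says that D(s,t) is in the centroid of g, so it preserves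
    both central series, hence J, and induces eps(s,t) on g/J = h, again in the
    centroid.  With s = 1 the right-hand side depends on the product of the two
    indices only; hence D(s,t) - D(st,1) has central values, the centre lies in
    J, and eps(s,t) = eps(st,1).  Likewise D(s,t) = D(t,s) on [g,g].

    If eps(s,t) = 0 for all t, the image of every D(s,t) lies in J, which is
    B-orthogonal to i since Z_k is orthogonal to g^k.  As i lies in [g,g], for
    y in i this gives C (y (x) s) (x (x) t) = B (D(s,t) y) x = B (D(t,s) y) x
    = C (y (x) t) (x (x) s) = B (D(s,t) x) y = 0, so y (x) s = 0.  Since
    i = h^* is non-zero, s = 0. *)

(** * Canonical ideals, the centroid and invariant metrics *)

Section CanonicalIdeals.
Variables (F : fieldType) (L : vectType F) (br : {bilinear L -> L -> L}).

Lemma lie_skew : is_lie_bracket br -> forall x y, br x y = - br y x.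
Proof.
move=> [brxx _] x y; apply/eqP; rewrite -addr_eq0; apply/eqP.
by have := brxx (x + y); rewrite linearDl !linearDr !brxx add0r addr0.
Qed.

Lemma mem_bracketv (U V : {vspace L}) u v :
  u \in U -> v \in V -> br u v \in bracketv br U V.
Proof. by move: u v; apply/bracketvP. Qed.

Lemma lcs_sub_derived k x : (0 < k)%N -> x \in lcs br k -> x \in lcs br 1.
Proof.
case: k => // k _; apply/subvP/bracketvP => u v _ _.
by apply: mem_bracketv; exact: memvf.
Qed.

Lemma ideal_i_sub_derived x : in_ideal_i br x -> x \in lcs br 1.
Proof.
case=> n; apply/subvP; rewrite big_nat.
apply: (big_ind (fun V => V <= lcs br 1)%VS) => [|U V UD VD|k /andP[k_gt0 _]].
- exact: sub0v.
- by rewrite subv_add UD.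
apply: (subv_trans (capvSr _ _)); apply/subvP => y; exact: lcs_sub_derived.
Qed.

Lemma center_sub_ideal_J x : (forall y, br x y = 0) -> in_ideal_J br x.
Proof.
move=> xZ [//|k] _; apply: (subvP (addvSl _ _)).
by apply/centerv_modP => y; rewrite xZ mem0v.
Qed.

Hypothesis lie : is_lie_bracket br.

Section Centroid.
Variable T : 'End(L).
Hypothesis cT : in_centroid br T.

Lemma centroidl x y : T (br x y) = br (T x) y.
Proof. by rewrite (lie_skew lie x) linearN /= cT -(lie_skew lie). Qed.

Lemma lcs_centroid k x : x \in lcs br k -> T x \in lcs br k.
Proof.
elim: k x => [|k IH] x; first by rewrite !memvf.
rewrite memv_preim; apply: subvP x; apply/bracketvP => u v _ vL.
by rewrite -memv_preim cT; apply: mem_bracketv; [exact: memvf|exact: IH].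
Qed.

Lemma ucs_centroid k x : x \in ucs br k -> T x \in ucs br k.
Proof.
elim: k x => [|k IH] x; first by rewrite !memv0 => /eqP->; rewrite linear0.
move/centerv_modP => xZ; apply/centerv_modP => y.
by rewrite -centroidl; exact: IH.
Qed.

Lemma ideal_J_centroid x : in_ideal_J br x -> in_ideal_J br (T x).
Proof.
move=> xJ k /xJ/memv_addP[p pZ [q qL ->]].
by rewrite linearD memv_add ?lcs_centroid ?ucs_centroid.
Qed.

End Centroid.

Section Orthogonality.
Variable B : {symmetric L}.
Hypothesis metB : invariant_metric br B.

Lemma ucs_lcs_orth k x y :
  x \in ucs br k -> y \in lcs br k -> B x y = 0.
Proof.
elim: k x y => [|k IH] x y; first by rewrite memv0 => /eqP-> _; rewrite linear0l.
move=> /centerv_modP xZ yL; pose f : {linear L -> F^o} := B x.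
suff /subvP/(_ _ yL): (lcs br k.+1 <= lker (linfun f))%VS.
  by rewrite memv_ker lfunE => /eqP.
apply/bracketvP => u v _ vL; rewrite memv_ker lfunE /= {}/f.
have [_ invB] := metB.
rewrite -[B x _]opprK -invB (lie_skew lie) linearNl opprK.
by apply/eqP; exact: IH.
Qed.

Lemma ideal_J_i_orth x y : in_ideal_J br x -> in_ideal_i br y -> B x y = 0.
Proof.
move=> xJ [n]; rewrite big_nat; move: y.
apply: (big_ind (fun V : {vspace L} => forall y, y \in V -> B x y = 0)).
- by move=> y; rewrite memv0 => /eqP->; rewrite linear0r.
- move=> U V UD VD _ /memv_addP[u uU [v vV ->]].
  by rewrite linearDr /= UD // VD // addr0.
move=> k /andP[k_gt0 _] y; rewrite memv_cap => /andP[yZ yL].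
have /memv_addP[p pZ [q qL ->]] := xJ k k_gt0.
rewrite linearDl /= (ucs_lcs_orth pZ yL).
by rewrite symmetricP (ucs_lcs_orth yZ qL) addr0.
Qed.

End Orthogonality.
End CanonicalIdeals.

(** * Adjoints with respect to a non-degenerate form *)

Section LinearMaps.
Variables (F : fieldType) (U V : vectType F) (f : U -> V) (f_lin : linear f).

Definition lfun_of_linear : 'Hom(U, V) :=
  linfun (HB.pack f (GRing.isLinear.Build _ _ _ _ _ f_lin) : {linear U -> V}).

Lemma lfun_of_linearE x : lfun_of_linear x = f x.
Proof. exact: lfunE. Qed.

End LinearMaps.

Section FormFunctional.
Variables (F : fieldType) (L : vectType F) (B : {symmetric L}).

(** B x as an element of the dual space. *)
Definition form_functional (x : L) : 'Hom(L, F^o) :=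
  linfun (B x : {linear L -> F^o}).

Lemma form_functional_linear : linear form_functional.
Proof.
move=> c x y; apply/lfunP => z.
rewrite add_lfunE scale_lfunE !lfunE /=.
by rewrite linearDl linearZl_LR.
Qed.

(** The map x |-> B x from L to its dual. *)
Definition form_dual : 'Hom(L, 'Hom(L, F^o)) :=
  lfun_of_linear form_functional_linear.

End FormFunctional.

Section Representability.
Variables (F : fieldType) (L : vectType F) (B : {symmetric L}).
Hypothesis ndB : nondegenerate B.

Lemma nondegenerate_inj x y : (forall z, B x z = B y z) -> x = y.
Proof.
move=> Bxy; apply/eqP; rewrite -subr_eq0; apply/eqP.
by apply: (nondegenerateP B ndB) => z; rewrite linearBl /= Bxy subrr.
Qed.

(** The vector representing a functional through B (see rieszE); it is
    meaningful for non-degenerate B only. *)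
Definition riesz : 'Hom('Hom(L, F^o), L) := ((form_dual B)^-1)%VF.

Lemma rieszE (f : 'Hom(L, F^o)) y : B (riesz f) y = f y.
Proof.
have kB : lker (form_dual B) = 0%VS.
  apply/eqP/lker0P => u v; rewrite !lfun_of_linearE => /lfunP Buv.
  by apply: nondegenerate_inj => z; have := Buv z; rewrite !lfunE.
have fB : f \in limg (form_dual B).
  suff -> : limg (form_dual B) = fullv by exact: memvf.
  apply/eqP; rewrite eqEdim subvf limg_dim_eq ?kB ?capv0 //.
  (* The dual of L has dimension dim L * 1. *)
  by rewrite !dimvf /dim /= muln1.
have /(congr1 (fun u : 'Hom(L, F^o) => u y)) := limg_lfunVK fB.
by rewrite lfun_of_linearE lfunE.
Qed.

Variables (V : vectType F) (C : {symmetric V}) (f : 'Hom(L, V)).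

Definition adjoint_fun (X : V) : L := riesz (form_functional C X \o f)%VF.

Lemma adjoint_funE X y : B (adjoint_fun X) y = C X (f y).
Proof. by rewrite rieszE comp_lfunE lfunE. Qed.

Lemma adjoint_fun_linear : linear adjoint_fun.
Proof.
move=> c X Y; apply: nondegenerate_inj => z.
by rewrite linearDl linearZl_LR /= !adjoint_funE linearDl linearZl_LR.
Qed.

(** The adjoint of f : L -> V with respect to the form B on L, which is
    non-degenerate, and an arbitrary symmetric form C on V. *)
Definition adjoint : 'Hom(V, L) :=
  lfun_of_linear adjoint_fun_linear.

Lemma adjointE X y : B (adjoint X) y = C X (f y).
Proof. by rewrite lfun_of_linearE adjoint_funE. Qed.

End Representability.

(** * Components of an invariant metric on a current algebra *)

Section Components.
Variables (F : fieldType) (L : vectType F) (br : {bilinear L -> L -> L}).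
Hypothesis lie : is_lie_bracket br.
Variable B : {symmetric L}.
Hypothesis metB : invariant_metric br B.
Variables (S : falgType F) (S_comm : commutative (@GRing.mul S)).
Variable C : {symmetric tensor L S}.
Hypothesis metC : invariant_metric (current_bracket S br) C.

(** The linear map x |-> x (x) s. *)
Definition tensl (s : S) : 'Hom(L, tensor L S) :=
  linfun (applyr (@tens F L S : {bilinear L -> S -> tensor L S}) s).

(** The endomorphism D(s,t) of L with
    B (D(s,t) x) y = C (x (x) s) (y (x) t). *)
Definition component (s t : S) : 'End(L) :=
  (adjoint (proj1 metB) C (tensl t) \o tensl s)%VF.

Lemma componentE s t x y :
  B (component s t x) y = C (tens x s) (tens y t).
Proof. by rewrite comp_lfunE adjointE !lfunE. Qed.

(** componentE characterizes the component: linearity in s and in t follows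
    from this uniqueness. *)
Lemma component_eq (T : 'End(L)) s t :
  (forall x y, B (T x) y = C (tens x s) (tens y t)) -> T = component s t.
Proof.
move=> TE; apply/lfunP => x; apply: (nondegenerate_inj (proj1 metB)) => y.
by rewrite TE componentE.
Qed.

Lemma component_bilinear :
  (forall t, linear (component^~ t)) * (forall s, linear (component s)).
Proof.
split=> [t|s] c u v; symmetry; apply: component_eq => x y;
  rewrite add_lfunE scale_lfunE linearDl linearZl_LR /= !componentE.
  by rewrite linearDr linearZr_LR /= linearDl linearZl_LR.
by rewrite [in RHS]linearDr [in RHS]linearZr_LR /= linearDr linearZr_LR.
Qed.

Lemma component_bracket r s t x y :
  component (r * s) t (br x y) = br x (component s (r * t) y).
Proof.
apply: (nondegenerate_inj (proj1 metB)) => z.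
rewrite componentE -current_bracket_tens (proj2 metC) current_bracket_tens.
by rewrite (proj2 metB) componentE.
Qed.

Lemma component_centroid s t : in_centroid br (component s t).
Proof. by move=> x y; rewrite -[s in LHS]mul1r component_bracket mul1r. Qed.

Lemma component_derived s t x :
  x \in lcs br 1 -> component s t x = component t s x.
Proof.
move=> x1; apply/eqP; rewrite -subr_eq0 -opp_lfunE -add_lfunE -memv_ker.
move: x x1; apply/subvP/bracketvP => x y _ _.
rewrite memv_ker add_lfunE opp_lfunE subr_eq0.
(* The two sides are [x, D(1,st) y] and [x, D(1,ts) y]. *)
rewrite -{1}[s]mulr1 -{1}[t in X in _ == X]mulr1.
by rewrite !component_bracket S_comm.
Qed.

(** Modulo the centre, D(s,t) depends on the product st only. *)
Lemma component_center s t x y :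
  br (component s t x - component (s * t) 1 x) y = 0.
Proof.
(* Both brackets are [x, D(1,st) y]. *)
rewrite linearBl /= -!(centroidl lie (component_centroid _ _)).
rewrite -{1}[s]mulr1 -[X in component X 1]mulr1.
by rewrite !component_bracket mulr1 subrr.
Qed.

(** This is where i(L) being both contained in [L, L] and orthogonal to J(L)
    is used. *)
Lemma tens_ideal_i_eq0 s y :
  (forall t x, in_ideal_J br (component s t x)) -> in_ideal_i br y ->
  tens y s = 0.
Proof.
move=> DJ yi; apply: (nondegenerateP C (proj1 metC)) => X.
elim/tensor_ind: X => [|X Y IHX IHY|x t]; first by rewrite linear0r.
  by rewrite linearDr /= IHX IHY addr0.
(* The two indices are exchanged twice: on [L, L] in the component, and by
   the symmetry of C. *)
rewrite -componentE component_derived; last exact: ideal_i_sub_derived yi.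
rewrite componentE symmetricP -componentE.
exact: (ideal_J_i_orth lie metB (DJ t x) yi).
Qed.

End Components.

(** * The bilinear map into the centroid of h *)

Lemma tens_eq0 (F : fieldType) (U V : vectType F) (u : U) (v : V) :
  tens u v = 0 -> u = 0 \/ v = 0.
Proof.
move=> uv0; case: (eqVneq u 0) => [|u_neq0]; [by left|right].
rewrite (coord_basisv v) big1 // => j _.
have [i ui] : exists i, coord (vbasis {:U}) i u != 0.
  apply/existsP; apply: contraNT u_neq0; rewrite negb_exists => /forallP u0.
  rewrite (coord_basisv u) big1 // => i _.
  by have /eqP-> := negbNE (u0 i); rewrite scale0r.
have /matrixP/(_ i j)/eqP := uv0.
by rewrite !mxE mulf_eq0 (negPf ui) => /eqP->; rewrite scale0r.
Qed.

Lemma bilinear_ex (F : fieldType) (U V W : vectType F) (f : U -> V -> W) :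
  (forall v, linear (f^~ v)) -> (forall u, linear (f u)) ->
  exists g : {bilinear U -> V -> W}, forall u v, g u v = f u v.
Proof.
move=> fl fr.
pose m := isBilinear.Build F U V W *:%R *:%R f
  (fun y => zmod_morphism_linear (fl y)) (fun x => zmod_morphism_linear (fr x))
  (fun y => scalable_linear (fl y)) (fun x => scalable_linear (fr x)).
pose g : {bilinear U -> V -> W} := HB.pack f m.
by exists g.
Qed.

Theorem theorem3p1 (F : fieldType) (charF0 : [pchar F] =i pred0)
    (h a : vectType F) (brh : {bilinear h -> h -> h})
    (lie_h : is_lie_bracket brh)
    (lam : {bilinear h -> h -> a}) (mu : {bilinear h -> h -> 'Hom(h, F^o)})
    (phi : {linear h -> 'Hom(a, 'Hom(h, F^o))})
    (data : coadjoint_data brh lam mu phi)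
    (g_nonab : ~ abelian_lie (ext_bracket brh lam mu phi))
    (g_nilp : nilpotent_lie (ext_bracket brh lam mu phi))
    (g_quad : admits_invariant_metric (ext_bracket brh lam mu phi))
    (g_i : forall p : ext_space h a,
       in_ideal_i (ext_bracket brh lam mu phi) p <-> p.1 = 0)
    (g_J : forall p : ext_space h a,
       in_ideal_J (ext_bracket brh lam mu phi) p <-> p.1.1 = 0)
    (S : falgType F) (S_comm : commutative (@GRing.mul S))
    (gS_quad :
       admits_invariant_metric (current_bracket S (ext_bracket brh lam mu phi)))
    (h_nonab : ~ abelian_lie brh) :
  exists eps : {bilinear S -> S -> 'End(h)},
    [/\ forall s t, in_centroid brh (eps s t),
        forall s t, eps s t = eps (s * t) 1
      & forall s, (forall t, eps s t = 0) -> s = 0].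
Proof.
have [B metB] := g_quad; have [C metC] := gS_quad.
have lie_g := ext_bracket_is_lie charF0 lie_h data.
set br := ext_bracket brh lam mu phi in g_i g_J B metB C metC lie_g *.
pose D := component metB C.
have D_cent s t : in_centroid br (D s t) by exact: component_centroid.
have brE p q : (br p q).1.1 = brh p.1.1 q.1.1.
  by case: p q => [[? ?] ?] [[? ?] ?].
(* eps(s,t) is D(s,t) compressed to h by the inclusion of h in g and the
   projection of g onto h. *)
have in_h_linear : linear (fun x : h => (x, 0, 0) : ext_space h a).
  by move=> c x y; apply: ext_spaceP; rewrite /= ?scaler0 ?addr0.
have to_h_linear : linear (fun p : ext_space h a => p.1.1) by [].
pose E s t : 'End(h) :=
  (lfun_of_linear to_h_linear \o D s t \o lfun_of_linear in_h_linear)%VF.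
have EE s t x : E s t x = (D s t (x, 0, 0)).1.1.
  by rewrite [LHS]comp_lfunE [LHS]comp_lfunE 2!lfun_of_linearE.
have [Dl Dr] := component_bilinear metB C.
have [||eps epsE] := @bilinear_ex _ _ _ _ E.
- move=> t c s s'; apply/lfunP => x.
  by rewrite add_lfunE scale_lfunE !EE /D Dl add_lfunE scale_lfunE.
- move=> s c t t'; apply/lfunP => x.
  by rewrite add_lfunE scale_lfunE !EE /D Dr add_lfunE scale_lfunE.
(* D s t preserves J, the kernel of the projection to h, so it induces E s t
   on the quotient. *)
have ED s t p : (D s t p).1.1 = E s t p.1.1.
  apply/eqP; rewrite EE -subr_eq0; apply/eqP.
  have /(ideal_J_centroid lie_g (D_cent s t))/g_J :
    in_ideal_J br (p - (p.1.1, 0, 0)) by apply/g_J; rewrite /= subrr.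
  by rewrite linearB.
exists eps; split=> [s t x y|s t|s eps0].
- have /(congr1 (fun p => p.1.1)) := D_cent s t (x, 0, 0) (y, 0, 0).
  by rewrite !epsE ED !brE ED.
- rewrite !epsE; apply/lfunP => x; rewrite !EE.
  apply/eqP; rewrite -subr_eq0; apply/eqP.
  by apply/(g_J (_ - _))/center_sub_ideal_J => y; exact: component_center.
have tens0 (y : ext_space h a) : in_ideal_i br y -> tens y s = 0.
  apply: (tens_ideal_i_eq0 lie_g (metB := metB) S_comm metC) => t x.
  by apply/g_J; rewrite -/D ED -epsE eps0 zero_lfunE.
case: (eqVneq s 0) => // s_neq0; case: h_nonab => x y.
rewrite (coord_basisv (brh x y)) big1 // => i _.
(* The i-th coordinate functional is an element of i(g). *)
pose ci : {linear h -> F^o} := coord (vbasis {:h}) i.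
pose alpha : 'Hom(h, F^o) := linfun ci.
have /tens0/tens_eq0[alpha0 | s0] :
  in_ideal_i br (0, 0, alpha) by apply/g_i.
  suff -> : coord (vbasis {:h}) i (brh x y) = 0 by rewrite scale0r.
  have := congr1 (fun p : ext_space h a => p.2 (brh x y)) alpha0.
  by rewrite lfunE zero_lfunE.
by rewrite s0 eqxx in s_neq0.
Qed.
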